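(* Consider $\dot x=f(x,t)$ on $\mathbb R^{2N}$, semi-contracting on a convex domain $\mathcal D\subseteq\mathbb R^{2N}$ with respect to $\|\cdot\|_R$ with rate $c>0$. Let $x_c(t)\in\mathcal D$, $t\ge0$, be an absolutely continuous reference trajectory (not necessarily a solution). Define the residual vector $d(t):=f(x_c(t),t)-\dot x_c(t)$ and its seminorm $r(t):=\|d(t)\|_R$. Let $x(t)$ be a solution of $\dot x=f(x,t)$, and let the scalar $\rho(t)$ satisfy $$\dot\rho(t)=-c\,\rho(t)+r(t),\qquad \rho(0)\ge\inf_{v\in\ker(R)}\|x(0)-(x_c(0)+v)\|_R .$$ Then $$\inf_{v\in\ker(R)}\|x(t)-(x_c(t)+v)\|_R\le\rho(t)\qquad\text{for all }t\ge0 .$$ Consequently, the time-varying tube $$\mathcal T(t):=\Big\{x\ :\ \inf_{v\in\ker(R)}\|x-(x_c(t)+v)\|_R\le\rho(t)\Big\}$$ is forward-invariant.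
   Context: $N\ge2$. $R_\theta\in\mathbb R^{(N-1)\times N}$ has orthonormal rows spanning $\mathrm{span}\{\mathbf 1_N\}^\perp$; $R:=\mathrm{blkdiag}(R_\theta,I_N)\in\mathbb R^{(2N-1)\times2N}$; $\|x\|_R:=\|Rx\|_2$ is a seminorm on $\mathbb R^{2N}$ with kernel $\ker(R)=\mathrm{span}\{[\mathbf 1_N^\top,\mathbf 0_N^\top]^\top\}$. $f:\mathbb R^{2N}\times[0,\infty)\to\mathbb R^{2N}$ is continuously differentiable in $x$ for each $t$, with Jacobian $Df(x,t)$ in $x$. For $A\in\mathbb R^{2N\times2N}$, $\|A\|_R:=\max\{\|Az\|_R: z\perp\ker(R),\ \|z\|_R=1\}$ and $\mu_R(A):=\lim_{h\to0^+}\frac{\|I+hA\|_R-1}{h}$, which equals $\lambda_{\max}\big(\tfrac12(RAR^\top+RA^\top R^\top)\big)$. The system is semi-contracting on the convex set $\mathcal D$ with rate $c>0$ with respect to $\|\cdot\|_R$ if $\mu_R(Df(x,t))\le -c$ for all $x\in\mathcal D$, $t\ge0$. Standing property of the systems considered: the kernel is infinitesimally invariant on $\mathcal D$, i.e. $Df(x,t)\ker(R)\subseteq\ker(R)$ for all $x\in\mathcal D$, $t\ge0$. Forward invariance of $\mathcal T(t)$ means that solutions starting in the tube remain in it: $x(t_0)\in\mathcal T(t_0)$ implies $x(t)\in\mathcal T(t)$ for all $t\ge t_0$.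
   Formalization: The solution x(t) is additionally assumed to stay in D (also in the forward-invariance claim, on the interval considered); without this the claim fails, e.g. for f(θ,ω)=(−θ,−ω+ω³), D={|ω_i|<1/2}, x_c=0 and the equilibrium x=(0,1) outside D. *)

(* Defs.v *)
From HB Require Import structures.
From mathcomp Require Export all_boot all_order all_algebra.
From mathcomp Require Export all_classical all_reals all_analysis.
Export numFieldNormedType.Exports.

Set Implicit Arguments.
Unset Strict Implicit.
Unset Printing Implicit Defensive.

Import Order.TTheory GRing.Theory Num.Theory.

Local Open Scope classical_set_scope.
Local Open Scope ring_scope.

Section Seminorm.
Variable R : realType.

(* The library norm on matrices is the max norm, hence this definition. *)
Definition norm2 n (x : 'cV[R]_n) : R := Num.sqrt (\sum_i x i 0 ^+ 2).

Variables (p n : nat) (P : 'M[R]_(p, n)).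

Definition seminorm (x : 'cV[R]_n) : R := norm2 (P *m x).

Definition ker : set 'cV[R]_n := [set v | P *m v = 0].

Definition orth_ker : set 'cV[R]_n := [set z | forall v, ker v -> v^T *m z = 0].

(* The maximum is attained as soon as P <> 0, so sup is max. *)
Definition op_seminorm (A : 'M[R]_n) : R :=
  sup [set seminorm (A *m z) | z in orth_ker `&` [set z | seminorm z = 1]].

Definition lognorm (A : 'M[R]_n) : R :=
  lim ((fun h : R => (op_seminorm (1%:M + h *: A) - 1) / h) @ 0^'+).

Definition dist_mod_ker (x y : 'cV[R]_n) : R :=
  inf [set seminorm (x - (y + v)) | v in ker].

End Seminorm.

Section AbsolutelyContinuous.
Variables (R : realType) (V : normedModType R).

(* Absolute continuity on every compact subinterval of J. *)
Definition loc_abs_continuous (J : set R) (g : R -> V) : Prop :=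
  forall a b : R, `[a, b]%classic `<=` J ->
  forall e : R, 0 < e -> exists2 d : R, 0 < d &
  forall (m : nat) (u v : 'I_m -> R),
    (forall i, a <= u i /\ u i <= v i /\ v i <= b) ->
    trivIset [set: 'I_m] (fun i => `]u i, v i[%classic) ->
    \sum_i (v i - u i) < d ->
    \sum_i `|g (v i) - g (u i)| < e.

(* Solutions are in the sense of Caratheodory, as the vector field is not
   assumed to depend continuously (nor measurably) on time. *)
Definition solution (F : V -> R -> V) (J : set R) (x : R -> V) : Prop :=
  loc_abs_continuous J x /\
  {ae lebesgue_measure, forall t : R, J t -> is_derive t 1 x (F (x t) t)}.

End AbsolutelyContinuous.

Section System.
Variables (R : realType) (n : nat) (f : 'cV[R]_n -> R -> 'cV[R]_n).

(* The field f is only ever evaluated at times t >= 0; its Jacobian is taken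
   with the column-vector convention, (Df)_ij = d f_i / d x_j. *)
Definition Df (x : 'cV[R]_n) (t : R) : 'M[R]_n :=
  \matrix_(i, j) ('D_(delta_mx j 0) (f^~ t) x) i 0.

Definition C1_in_space : Prop := forall t : R, 0 <= t ->
  (forall x, differentiable (f^~ t) x) /\ continuous (Df^~ t).

Definition semi_contracting p (P : 'M[R]_(p, n)) (D : set 'cV[R]_n) (c : R) :=
  forall x t, D x -> 0 <= t -> lognorm P (Df x t) <= - c.

Definition ker_infinitesimally_invariant p (P : 'M[R]_(p, n))
    (D : set 'cV[R]_n) :=
  forall x t v, D x -> 0 <= t -> ker P v -> ker P (Df x t *m v).

(* derive1 xc is total; its value where xc is not differentiable (a null set for
   absolutely continuous xc) is irrelevant. *)
Definition residual (xc : R -> 'cV[R]_n) (t : R) : 'cV[R]_n :=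
  f (xc t) t - derive1 xc t.

(* T is forward invariant for the system with state space D: a solution that
   evolves in D on [t0, b), with b possibly +oo, and starts in T t0 stays in
   the tube on the whole of [t0, b). *)
Definition forward_invariant (D : set 'cV[R]_n) (T : R -> set 'cV[R]_n) :=
  forall (t0 : R) (b : \bar R) (x : R -> 'cV[R]_n), 0 <= t0 ->
  let J := [set t : R | t0 <= t /\ (t%:E < b)%E] in
  solution f J x -> (forall t, J t -> D (x t)) ->
  T t0 (x t0) -> forall t, J t -> T t (x t).

End System.

Definition tube (R : realType) p n (P : 'M[R]_(p, n)) (xc : R -> 'cV[R]_n)
    (rho : R -> R) (t : R) : set 'cV[R]_n :=
  [set x | dist_mod_ker P x (xc t) <= rho t].

Definition orthonormal_rows_ones_perp (R : realType) N
    (Rt : 'M[R]_(N.-1, N)) : Prop :=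
  Rt *m Rt^T = 1%:M /\
  forall v : 'rV[R]_N, (v <= Rt)%MS <-> v *m (const_mx 1 : 'cV[R]_N) = 0.

Definition blkR (R : realType) N (Rt : 'M[R]_(N.-1, N)) :
  'M[R]_(N.-1 + N, N + N) := block_mx Rt 0 0 1%:M.

(* Main.v *)
(** Modulo ker P the error x - xc is measured by V = |P (x - xc)|, and
    P P^T = 1. Since the kernel is invariant, <P e, P A e> <= mu_P(A) |P e|^2;
    the mean value theorem along the segment from xc to x (contained in D)
    turns this into <P e, P (f x - f xc)> <= - c V^2. For h > 0 the smooth
    substitute S = sqrt (V^2 + h^2) of V then satisfies, at almost every time,
    w' <= 0 as soon as w := S - rho - h is positive. As w is absolutely
    continuous it stays nonpositive, and h tends to 0.

    Absolute continuity enters through the fundamental theorem of calculus for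
    the Lebesgue integral: F is the difference of two nondecreasing absolutely
    continuous functions (its total variation is one), and the
    Lebesgue-Stieltjes measure of such a function is dominated by the Lebesgue
    measure, hence has a density. In particular the reference trajectory is
    differentiable almost everywhere, so that the residual is meaningful. *)
From mathcomp Require Import measurable_realfun.
From HB Require Import structures.
Require Import Defs.
From mathcomp Require Import ring lra.
Set Implicit Arguments.
Unset Strict Implicit.
Unset Printing Implicit Defensive.
Import Order.TTheory GRing.Theory Num.Theory.
Local Open Scope classical_set_scope.
Local Open Scope ring_scope.

(** * Absolutely continuous functions *)

(* Uniform on the whole line: a function on [a, b] is first extended by its
   boundary values, see clamp. *)
Definition abs_continuous {R : realType} (F : R -> R) :=
  forall e, 0 < e -> exists2 d, 0 < d & forall (I : finType) (u v : I -> R),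
    (forall i, u i <= v i) ->
    trivIset [set: I] (fun i => `]u i, v i[%classic) ->
    \sum_i (v i - u i) < d -> \sum_i `|F (v i) - F (u i)| < e.

(** * Total variation of absolutely continuous functions *)

Section total_variation.
Context {R : realType}.
Implicit Types (F : R -> R).

Lemma itv_partition_leq_nth (a b : R) s k l : itv_partition a b s ->
  (k <= l <= size s)%N -> nth b (a :: s) k <= nth b (a :: s) l.
Proof.
move=> abs /andP[kl ls].
have srt : sorted <=%R (a :: s).
  by apply: (@sub_sorted _ <%R) => [x y /ltW//|]; case: abs.
apply: (sorted_leq_nth le_trans le_refl) => //; rewrite inE/= ltnS//.
exact: leq_trans ls.
Qed.

(** All pieces of all partitions form one disjoint finite family, indexed by the dependent pairs [J]
    and of the same total length. Absolute continuity applied to this family bounds the sum of the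
    variations. *)
Lemma abs_continuous_variation F : abs_continuous F ->
  forall e, 0 < e -> exists2 d, 0 < d & forall (I : finType) (u v : I -> R)
    (s : I -> seq R),
    (forall i, itv_partition (u i) (v i) (s i)) ->
    trivIset [set: I] (fun i => `]u i, v i[%classic) ->
    \sum_i (v i - u i) < d -> \sum_i variation (u i) (v i) F (s i) < e.
Proof.
move=> acF e /acF[d d0 dF]; exists d => // I u v s ps tI sd.
pose J := {i : I & 'I_(size (s i))}.
pose x i k := nth (v i) (u i :: s i) k.
have varE G : \sum_i variation (u i) (v i) G (s i) =
    \sum_(p : J) `|G (x (tag p) (tagged p).+1) - G (x (tag p) (tagged p))|.
  rewrite (eq_bigr (fun i => \sum_(k < size (s i))
    `|G (x i k.+1) - G (x i k)|)); last by move=> i _; rewrite /variation big_mkord.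
  by rewrite sig_big_dep.
have xle i k l : (k <= l <= size (s i))%N -> x i k <= x i l.
  exact: itv_partition_leq_nth.
rewrite varE; apply: (dF J (fun p => x (tag p) (tagged p))
  (fun p => x (tag p) (tagged p).+1)).
- by move=> p; apply: xle; rewrite leqnSn /=.
- apply/trivIsetP => -[i k] [j l] _ _ /=; apply: contra_neqP => /eqP/set0P[z].
  rewrite /= !in_itv/= => -[/andP[z1 z2] /andP[z3 z4]].
  have ij : i = j.
    apply: (tI i j) => //; exists z; rewrite /= !in_itv/=; split; apply/andP; split.
    + by apply: le_lt_trans z1; rewrite -[leLHS]/(x i 0%N); apply: xle; rewrite leq0n /= ltnW.
    + by apply: (lt_le_trans z2); apply: itv_partition_nth_le (ps i); rewrite ltnS ltn_ord.
    + by apply: le_lt_trans z3; rewrite -[leLHS]/(x j 0%N); apply: xle; rewrite leq0n /= ltnW.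
    + by apply: (lt_le_trans z4); apply: itv_partition_nth_le (ps j); rewrite ltnS ltn_ord.
  (* Two overlapping pieces of the same partition coincide: if [k < l], piece [k] ends no later than
     piece [l] starts. *)
  subst j; congr Tagged; apply/val_inj/eqP => /=.
  case: ltngtP => // kl.
  - have := xle i k.+1 l; rewrite kl/= => /(_ (ltnW (ltn_ord _)))/(lt_le_trans z2).
    by move/(lt_trans z3); rewrite ltxx.
  - have := xle i l.+1 k; rewrite kl/= => /(_ (ltnW (ltn_ord _)))/(lt_le_trans z4).
    by move/(lt_trans z1); rewrite ltxx.
- apply: le_lt_trans sd.
  (* The total length of the pieces is bounded by the variation of the identity, which telescopes
     because the identity is monotone. *)
  apply: (@le_trans _ _ (\sum_i variation (u i) (v i) idfun (s i))).
    by rewrite varE ler_sum// => p _; exact: ler_norm.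
  by apply: ler_sum => i _; rewrite nondecreasing_variation.
Qed.

(** Taking suprema over partitions turns the strict bound into a large one. The suprema are first
    shown finite, so that a nearly optimal partition can be chosen on every interval. *)
Lemma abs_continuous_total_variation F : abs_continuous F ->
  forall e, 0 < e -> exists2 d, 0 < d & forall (I : finType) (u v : I -> R),
    (forall i, u i <= v i) ->
    trivIset [set: I] (fun i => `]u i, v i[%classic) ->
    \sum_i (v i - u i) < d ->
    (\sum_i total_variation (u i) (v i) F <= e%:E)%E.
Proof.
move=> /abs_continuous_variation acF e /acF[d d0 dF]; exists d => // I u v uv tI sd.
have TVfin i : total_variation (u i) (v i) F \is a fin_num.
  apply/bounded_variationP => //; exists e => _ [s ps <-]; apply/ltW.
  have := dF unit (fun=> u i) (fun=> v i) (fun=> s).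
  rewrite !(big_pred1 tt); [|by case..]; apply => //; first by move=> [] [].
  apply: le_lt_trans sd; rewrite (bigD1 i)//= lerDl sumr_ge0// => j _.
  by rewrite subr_ge0.
apply/lee_addgt0Pr => r r0.
(* The slack [r] is shared among the intervals; the successor avoids a division by zero when [I] is
   empty. *)
pose r' := r / #|I|.+1%:R.
have r'0 : 0 < r' by rewrite divr_gt0.
have adh i : exists s, itv_partition (u i) (v i) s /\
    (total_variation (u i) (v i) F <= (variation (u i) (v i) F s + r')%:E)%E.
  have [_ [_ [s ps <-] <-]] := ub_ereal_sup_adherent r'0 (TVfin i).
  by rewrite lteBlDr// => /ltW; exists s.
have [s /all_and2[ps TVs]] := choice adh.
apply: (@le_trans _ _ (\sum_i (variation (u i) (v i) F (s i) + r')%:E)%E).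
  exact: lee_sum.
rewrite sumEFin lee_fin big_split/= lerD//; first exact/ltW/dF.
rewrite sumr_const /r' -[leLHS]mulr_natr -mulrA ler_piMr ?ltW//.
by rewrite ltr_pdivrMl// mulr1 ltr_nat ltnS max_card.
Qed.

End total_variation.

(** * Densities of monotone absolutely continuous functions *)

Section monotone.
Context {R : realType}.
Implicit Types (F G : R -> R).
Local Notation mu := (@lebesgue_measure R).

Lemma abs_continuous1 F : abs_continuous F -> forall e, 0 < e ->
  exists2 d, 0 < d & forall u v, u <= v -> v - u < d -> `|F v - F u| < e.
Proof.
move=> acF e /acF[d d0 dF]; exists d => // u v uv vud.
have := dF unit (fun=> u) (fun=> v).
by rewrite !(big_pred1 tt); [|by case..]; apply => //; move=> [] [].
Qed.

Lemma abs_continuous_continuous F : abs_continuous F -> continuous F.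
Proof.
move=> /abs_continuous1 acF x; apply/cvgrPdist_lt => e /acF[d d0 dF].
near=> y.
have : `|x - y| < d by near: y; exact: (@nbhsx_ballx _ _ x d).
have [yx|/ltW xy] := leP y x.
  by rewrite ger0_norm ?subr_ge0//; exact: dF.
by rewrite distrC ger0_norm ?subr_ge0// distrC; exact: dF.
Unshelve. all: by end_near. Qed.

(** An open interval that is bounded and nonempty has its infimum and supremum as end points; an
    empty component is written as []0, 0[]. *)
Lemma open_disjoint_itv_itv (U : set R) (oU : open U) (n : nat) :
  has_lbound U -> has_ubound U ->
  exists x, x.1 <= x.2 /\ open_disjoint_itv oU n = `]x.1, x.2[%classic.
Proof.
move=> [l lU] [r rU]; set I := open_disjoint_itv oU n.
have IU : I `<=` U.
  by rewrite [X in _ `<=` X](open_disjoint_itv_bigcup oU); exact: bigcup_sup.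
have [I0|/set0P[x Ix]] := eqVneq I set0.
  by exists (0, 0); rewrite I0 set_itvoo0.
have lI : has_lbound I by exists l => y /IU /lU.
have rI : has_ubound I by exists r => y /IU /rU.
have IE := interval_bounded_interior (@open_disjoint_itv_is_interval _ _ oU n) lI rI.
exists (inf I, sup I); split => /=.
  by apply: (@le_trans _ _ x); [exact: ge_inf|exact: ub_le_sup].
transitivity (I°); first by apply/esym/interior_id; exact: open_disjoint_itv_open.
by rewrite IE; apply/seteqP; split => y /=; rewrite in_itv.
Qed.

Lemma lebesgue_stieltjes_measure_oc (G : cumulative R R) u v : u <= v ->
  lebesgue_stieltjes_measure G `]u, v]%classic = (G v - G u)%:E.
Proof.
move=> uv; rewrite /lebesgue_stieltjes_measure /measure_extension.
by rewrite measurable_mu_extE/=; [rewrite wlength_itv_bnd|exact: is_ocitv].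
Qed.

(** The components of [U] are countably many disjoint intervals. Absolute continuity bounds every
    finite partial sum of their increments, and the bound passes to the limit. *)
Lemma abs_continuous_stieltjes_open (G : cumulative R R) : abs_continuous G ->
  forall e, 0 < e -> exists2 d, 0 < d & forall U, open U ->
    has_lbound U -> has_ubound U -> (mu U < d%:E)%E ->
    (lebesgue_stieltjes_measure G U <= e%:E)%E.
Proof.
move=> acG e /acG[d d0 dG]; exists d => // U oU lU rU Ud.
pose I := open_disjoint_itv oU.
have UI : U = \bigcup_n I n by exact: open_disjoint_itv_bigcup.
have tI : trivIset [set: nat] I by exact: open_disjoint_itv_trivIset.
have /choice[x /all_and2[x12 IE]] n := open_disjoint_itv_itv oU n lU rU.
have mI n : measurable (I n) by rewrite /I IE; exact: measurable_itv.
have muE (nu : {measure set (measurableTypeR R) -> \bar R}) :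
    nu U = (\sum_(i <oo) nu (I i))%E.
  rewrite UI measure_semi_bigcup//.
  by apply: (@bigcup_measurable _ (measurableTypeR R)) => n _; exact: mI.
have GI n : (lebesgue_stieltjes_measure G (I n) <= (G (x n).2 - G (x n).1)%:E)%E.
  rewrite -lebesgue_stieltjes_measure_oc//; apply: le_measure; rewrite ?inE//.
    exact: mI.
  by rewrite /I IE; exact: subset_itv_oo_oc.
have muI i : mu (I i) = ((x i).2 - (x i).1)%:E.
  rewrite /I IE lebesgue_measure_itv/= lte_fin.
  by case: ltgtP (x12 i) => // ->; rewrite subrr.
rewrite (muE (lebesgue_stieltjes_measure G)).
apply: lime_le; first exact: is_cvg_nneseries.
near=> n.
apply: (@le_trans _ _ (\sum_(0 <= i < n) (G (x i).2 - G (x i).1)%:E)%E).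
  by apply: lee_sum => i _; exact: GI.
rewrite big_mkord sumEFin lee_fin.
apply: (@le_trans _ _ (\sum_(i < n) `|G (x i).2 - G (x i).1|)).
  by apply: ler_sum => i _; exact: ler_norm.
apply/ltW/(dG _ (fun i : 'I_n => (x i).1) (fun i : 'I_n => (x i).2)) => //.
  apply/trivIsetP => i j _ _ ij; rewrite -!IE.
  by move/trivIsetP : tI; apply => //; apply: contra_neq ij => /val_inj.
rewrite -lte_fin; apply: le_lt_trans Ud.
rewrite (muE mu); apply: le_trans (nneseries_lim_ge n _); last by [].
rewrite big_mkord -sumEFin; apply: lee_sum => i _.
by rewrite -muI; exact: lexx.
Unshelve. all: by end_near. Qed.

(** The density is a Radon-Nikodym derivative of the Stieltjes measure of [G], restricted to []a,
    b]] to make it finite. *)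
Lemma nondecreasing_abs_continuous_density G a b : a <= b ->
  {homo G : x y / x <= y} -> abs_continuous G ->
  exists2 h : R -> R, mu.-integrable [set: R] (EFin \o h) &
    forall t, a <= t <= b -> G t - G a = \int[mu]_(s in `]a, t]) h s.
Proof.
move=> ab ndG acG.
have rcG : right_continuous G.
  by apply: right_continuousW; exact: abs_continuous_continuous.
pose Gc : cumulative R R := HB.pack G (isCumulative.Build R _ R G ndG rcG).
have mab : measurable (`]a, b]%classic : set (measurableTypeR R)) by exact: measurable_itv.
have Gab : (lebesgue_stieltjes_measure Gc `]a, b]%classic < +oo)%E.
  by rewrite lebesgue_stieltjes_measure_oc// ltry.
pose nu : {finite_measure set (measurableTypeR R) -> \bar R} := mfrestr mab Gab.
(* A Lebesgue null set is enclosed in an open set of small Lebesgue measure, whose Stieltjes measure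
   is then small. *)
have numu : nu `<< mu.
  apply/null_content_dominatesP => N mN N0.
  apply/eqP; rewrite eq_le measure_ge0 andbT; apply/lee_addgt0Pr => e e0.
  rewrite add0e.
  have [d d0 dG] := abs_continuous_stieltjes_open (acG : abs_continuous Gc) e0.
  have [U [oU NU NUd]] : exists U, [/\ open U, N `<=` U & (mu (U `\` N) < d%:E)%E].
    by apply: lebesgue_regularity_outer => //; rewrite N0.
  have mU : measurable U by exact: open_measurable.
  have Ud : (mu U < d%:E)%E.
    rewrite (measureDI mu mU mN); apply: le_lt_trans NUd.
    rewrite geeDl// -N0; apply: le_measure; rewrite ?inE//; exact: measurableI.
  (* The open set is cut down to a bounded one that still contains the part of [N] in []a, b]]. *)
  pose V := U `&` `]a - 1, b + 1[%classic.
  have oV : open V by apply: openI => //; exact: interval_open.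
  have mV : measurable V by exact: open_measurable.
  apply: (@le_trans _ _ (lebesgue_stieltjes_measure Gc V)).
    apply: le_measure; rewrite ?inE//; first exact: measurableI.
    apply: setISS => //.
    by apply: subset_itvSoo; rewrite bnd_simp; lra.
  apply: dG => //.
  - by exists (a - 1) => x [_]; rewrite /= in_itv/= => /andP[/ltW].
  - by exists (b + 1) => x [_]; rewrite /= in_itv/= => /andP[_ /ltW].
  - by apply: le_lt_trans Ud; apply: le_measure; rewrite ?inE//; exact: subIsetl.
have [h [h0 hfin hint hE]] := radon_nikodym_sigma_finite numu.
exists (fine \o h).
  by apply: eq_integrable hint => // x _ /=; rewrite fineK.
move=> t /andP[a_t tb].
rewrite /Rintegral.
under eq_integral do rewrite /= fineK//.
rewrite -hE; last exact: measurable_itv.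
rewrite /nu/= /mfrestr /mrestr setIidl; last exact: subset_itvl.
by rewrite lebesgue_stieltjes_measure_oc.
Qed.

End monotone.

(** * Constant extension outside a compact interval *)

Section clamp.
Context {R : realType}.
Implicit Types (a b t u v : R).

Definition clamp a b t := Num.max a (Num.min t b).

Lemma clamp_itv a b t : a <= b -> a <= clamp a b t <= b.
Proof. by move=> ab; rewrite /clamp le_max lexx/= ge_max ab ge_min lexx orbT. Qed.

Lemma clamp_id a b t : a <= t <= b -> clamp a b t = t.
Proof. by move=> /andP[at_ tb]; rewrite /clamp (min_idPl tb) (max_idPr at_). Qed.

Lemma clamp_homo a b : {homo clamp a b : u v / u <= v}.
Proof.
by move=> u v uv; rewrite /clamp ge_max !le_max lexx/= le_min !ge_min lexx uv !orbT.
Qed.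

Lemma clamp_contract a b u v : a <= b -> u <= v ->
  clamp a b v - clamp a b u <= v - u.
Proof.
move=> ab uv; rewrite lerBlDr {1}/clamp ge_max; apply/andP; split.
  by have /andP[au _] := clamp_itv u ab; lra.
have : Num.min u b <= clamp a b u by rewrite /clamp le_max lexx orbT.
have [ub|bu] := leP u b => h; rewrite ge_min; apply/orP; [left|right]; lra.
Qed.

(** Hence clamping the end points of disjoint intervals leaves them disjoint. *)
Lemma subset_itv_clamp a b u v : a <= b ->
  `]clamp a b u, clamp a b v[ `<=` `]u, v[.
Proof.
move=> ab x; rewrite /= !in_itv/= /clamp gt_max gt_min lt_max lt_min.
move=> /andP[/andP[ax /orP ub] /orP xv].
have xb : x < b by case: xv => [/(lt_trans ax)|/andP[]//]; rewrite ltxx.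
case: ub => [->|/(lt_trans xb)]; last by rewrite ltxx.
by case: xv => [/(lt_trans ax)|/andP[->]//]; rewrite ltxx.
Qed.

End clamp.

(** * Absolute continuity on a compact interval through increments *)

Section ac_increments.
Context {R : realType}.
Implicit Types (a b : R) (w : R -> R -> R) (F : R -> R).

(* Absolute continuity on [a, b] of g is the case w s t = |g t - g s|; bounding
   increments passes it from several functions to one built from them. *)
Definition abs_continuous_increments a b w :=
  forall e, 0 < e -> exists2 d, 0 < d & forall (I : finType) (u v : I -> R),
    (forall i, a <= u i /\ u i <= v i /\ v i <= b) ->
    trivIset [set: I] (fun i => `]u i, v i[%classic) ->
    \sum_i (v i - u i) < d -> \sum_i w (u i) (v i) < e.

(** Enumerating [I] passes from families indexed by ordinals to families over any finite type. *)
Lemma loc_abs_continuous_increments (V : normedModType R) (J : set R)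
    (g : R -> V) a b : loc_abs_continuous J g -> `[a, b]%classic `<=` J ->
  abs_continuous_increments a b (fun s t => `|g t - g s|).
Proof.
move=> acg abJ e e0; have [d d0 dg] := acg a b abJ e e0; exists d => // I u v uv tI.
have reindexI G : \sum_(i : I) G i = \sum_(i < #|I|) G (enum_val i) :> R.
  by rewrite (reindex _ (onW_bij _ (enum_val_bij I))).
rewrite !reindexI; apply: dg => // i j _ _ ij.
by apply: enum_val_inj; exact: tI.
Qed.

Lemma abs_continuous_incrementsD a b w1 w2 :
  abs_continuous_increments a b w1 -> abs_continuous_increments a b w2 ->
  abs_continuous_increments a b (fun s t => w1 s t + w2 s t).
Proof.
move=> ac1 ac2 e e0; have e20 : 0 < e / 2 by rewrite divr_gt0.
have [d1 d10 dw1] := ac1 _ e20; have [d2 d20 dw2] := ac2 _ e20.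
exists (Num.min d1 d2); first by rewrite lt_min d10.
move=> I u v uv tI; rewrite lt_min => /andP[s1 s2].
by rewrite big_split/= (splitr e) ltrD//; [exact: dw1|exact: dw2].
Qed.

Lemma abs_continuous_incrementsZ a b k w :
  0 <= k -> abs_continuous_increments a b w ->
  abs_continuous_increments a b (fun s t => k * w s t).
Proof.
(* Dividing by [k + 1] rather than [k] covers [k = 0]. *)
move=> k0 ac e e0; have k1 : 0 < k + 1 by rewrite ltr_wpDl.
have [d d0 dw] := ac (e / (k + 1)) (divr_gt0 e0 k1).
exists d => // I u v uv tI /(dw I u v uv tI) => {dw}.
rewrite ltr_pdivlMr// -mulr_sumr.
have [s0|s0] := leP 0 (\sum_i w (u i) (v i)); first lra.
by move=> _; apply: le_lt_trans e0; rewrite mulr_ge0_le0// ltW.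
Qed.

Lemma le_abs_continuous_increments a b w1 w2 :
  (forall s t, a <= s -> s <= t -> t <= b -> w1 s t <= w2 s t) ->
  abs_continuous_increments a b w2 -> abs_continuous_increments a b w1.
Proof.
move=> w12 ac e /ac[d d0 dw]; exists d => // I u v uv tI /(dw I u v uv tI).
by apply: le_lt_trans; apply: ler_sum => i _; have [? [? ?]] := uv i; exact: w12.
Qed.

Lemma abs_continuous_clamp a b F : a <= b ->
  abs_continuous_increments a b (fun s t => `|F t - F s|) ->
  abs_continuous (F \o clamp a b).
Proof.
move=> ab ac e /ac[d d0 dF]; exists d => // I u v uv tI sd.
apply: (dF I (clamp a b \o u) (clamp a b \o v)) => /=.
- move=> i; have /andP[? _] := clamp_itv (u i) ab.
  by have /andP[_ ?] := clamp_itv (v i) ab; split => //; split => //; exact/clamp_homo.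
- move=> i j _ _ [x [xi xj]]; apply: tI => //.
  by exists x; split; exact: subset_itv_clamp ab _ _.
- by apply: le_lt_trans sd; apply: ler_sum => i _; exact: clamp_contract.
Qed.

(** Cut the interval into steps of length [d / 2], below the threshold [d] for variation 1; then [k]
    steps carry variation at most [k], and finitely many reach [b]. *)
Lemma abs_continuous_bounded_variation a b F : a <= b -> abs_continuous F ->
  bounded_variation a b F.
Proof.
move=> ab /abs_continuous_total_variation/(_ _ ltr01)[d d0 dF].
have TV1 u v : u <= v -> v - u < d -> (total_variation u v F <= 1%:E)%E.
  move=> uv vud; have := dF unit (fun=> u) (fun=> v).
  by rewrite !(big_pred1 tt); [|by case..]; apply => //; move=> [] [].
have d2 : 0 < d / 2 by rewrite divr_gt0.
have TVk k : (total_variation a (a + (d / 2) * k%:R) F <= k%:R%:E)%E.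
  elim: k => [|k IH]; first by rewrite mulr0 addr0 total_variationxx.
  have leS : a + d / 2 * k%:R <= a + d / 2 * k.+1%:R.
    by rewrite lerD2l ler_pM2l// ler_nat.
  rewrite (@total_variationD _ _ _ (a + d / 2 * k%:R))//.
    rewrite -[in leRHS]natr1 EFinD; apply: leeD => //; apply: TV1 => //.
    by rewrite -[k.+1%:R]natr1 mulrDr mulr1; lra.
  by rewrite lerDl mulr_ge0// ltW.
pose k := (Num.truncn ((b - a) / (d / 2))).+1.
have bk : b <= a + d / 2 * k%:R.
  rewrite -lerBlDl mulrC -ler_pdivrMr//; apply/ltW.
  exact: truncnS_gt.
apply: (@bounded_variationl _ a b (a + d / 2 * k%:R)) => //.
apply/bounded_variationP; first exact: le_trans bk.
rewrite ge0_fin_numE; first exact: le_lt_trans (TVk k) (ltry _).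
by apply: total_variation_ge0; exact: le_trans bk.
Qed.

End ac_increments.

(** * Fundamental theorem of calculus and comparison *)

Section density.
Context {R : realType}.
Implicit Types (F G : R -> R).
Local Notation mu := (@lebesgue_measure R).

Lemma abs_continuousD F G : abs_continuous F -> abs_continuous G ->
  abs_continuous (fun t => F t + G t).
Proof.
move=> acF acG e e0; have e20 : 0 < e / 2 by rewrite divr_gt0.
have [d1 d10 dF] := acF _ e20; have [d2 d20 dG] := acG _ e20.
exists (Num.min d1 d2); first by rewrite lt_min d10.
move=> I u v uv tI; rewrite lt_min => /andP[s1 s2].
apply: (@le_lt_trans _ _
    (\sum_i (`|F (v i) - F (u i)| + `|G (v i) - G (u i)|))).
  by apply: ler_sum => i _; rewrite opprD addrACA ler_normD.
by rewrite big_split/= (splitr e) ltrD//; [exact: dF|exact: dG].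
Qed.

Lemma abs_continuous_clampT a b F : a <= b -> abs_continuous F ->
  abs_continuous (F \o clamp a b).
Proof.
move=> ab acF; apply: abs_continuous_clamp => // e /acF[d d0 dF].
by exists d => // I u v uv; apply: dF => i; have [_ []] := uv i.
Qed.

(** By additivity, the increment of the variation function over an interval is the total variation
    of [F] on that interval. *)
Lemma abs_continuous_fine_total_variation a b F : a <= b -> abs_continuous F ->
  abs_continuous ((fun t => fine (total_variation a t F)) \o clamp a b).
Proof.
move=> ab acF; apply: abs_continuous_clamp => // e e0.
have e20 : 0 < e / 2 by rewrite divr_gt0.
have [d d0 dF] := abs_continuous_total_variation acF e20.
exists d => // I u v uv tI sd.
have TVfin s t : s <= t -> total_variation s t F \is a fin_num.
  by move=> st; apply/bounded_variationP => //; exact: abs_continuous_bounded_variation.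
apply: (@le_lt_trans _ _ (e / 2)); last by lra.
rewrite -lee_fin -sumEFin; apply: le_trans (dF I u v _ tI sd); last first.
  by move=> i; have [_ []] := uv i.
apply: lee_sum => i _; have [aui [uvi vib]] := uv i.
rewrite (total_variationD F aui uvi) fineD ?TVfin// addrAC subrr add0r.
by rewrite ger0_norm ?fineK ?TVfin// fine_ge0 ?total_variation_ge0.
Qed.

(** This is the Jordan decomposition of [F] as the difference of [V + F] and [V]: increments of [F]
    are dominated by those of its variation [V]. *)
Lemma total_variation_clamp_homo a b F : a <= b -> abs_continuous F ->
  {homo (fun t => fine (total_variation a t F)) \o clamp a b : s t / s <= t} /\
  {homo (fun t => fine (total_variation a t F) + F t) \o clamp a b : s t / s <= t}.
Proof.
move=> ab acF.
have TVfin s t : s <= t -> total_variation s t F \is a fin_num.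
  by move=> st; apply/bounded_variationP => //; exact: abs_continuous_bounded_variation.
have key s t : s <= t ->
    `|F (clamp a b t) - F (clamp a b s)| <=
    fine (total_variation a (clamp a b t) F) -
    fine (total_variation a (clamp a b s) F).
  move=> /(clamp_homo a b) st; have /andP[as_ _] := clamp_itv s ab.
  rewrite (total_variationD F as_ st) fineD ?TVfin// addrAC subrr add0r.
  by rewrite -lee_fin fineK ?TVfin// total_variation_ge.
split=> s t /key/=; first by move/(le_trans (normr_ge0 _)); rewrite subr_ge0.
by rewrite ler_norml => /andP[? _]; lra.
Qed.

(** The density is the difference of those of the two monotone parts; Lebesgue differentiation of
    its indefinite integral gives the derivative almost everywhere. *)
Lemma abs_continuous_density a b F : a <= b -> abs_continuous F ->
  exists h : R -> R, [/\ mu.-integrable [set: R] (EFin \o h),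
    forall t, a <= t <= b -> F t - F a = \int[mu]_(s in `]a, t]) h s &
    {ae mu, forall t, a < t < b -> is_derive t 1 F (h t)}].
Proof.
move=> ab acF; pose V t := fine (total_variation a t F).
have [ndV ndVF] := total_variation_clamp_homo ab acF.
have acV : abs_continuous (V \o clamp a b).
  exact: abs_continuous_fine_total_variation.
have acVF : abs_continuous ((fun t => V t + F t) \o clamp a b).
  by apply: abs_continuousD => //; exact: abs_continuous_clampT.
have [h1 ih1 h1E] := nondecreasing_abs_continuous_density ab ndV acV.
have [h2 ih2 h2E] := nondecreasing_abs_continuous_density ab ndVF acVF.
pose h t := h2 t - h1 t.
have ih : mu.-integrable [set: R] (EFin \o h).
  rewrite (_ : _ \o h = ((EFin \o h2) \- (EFin \o h1))%E)//.
  exact: integrableB.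
have hE t : a <= t <= b -> F t - F a = \int[mu]_(s in `]a, t]) h s.
  move=> atb; rewrite RintegralB//; [|exact: integrableS ih2|exact: integrableS ih1].
  by rewrite -h1E// -h2E//= !clamp_id ?lexx//; lra.
exists h; split => //.
have int_h y : mu.-integrable [set` Interval (BRight a) (BRight y)] (EFin \o h).
  exact: integrableS ih.
have := FTC1 int_h (open_integrable_locally openT ih).
apply: filterS; first exact: (ae_filter_ringOfSetsType mu).
move=> t ft /andP[at_ tb].
have aBt : (BRight a < BRight t)%O by rewrite bnd_simp.
have [dH HE] := ft aBt.
have [dF FE] : is_derive t 1 (fun y => F a + \int[mu]_(s in `]a, y]) h s) (h t).
  have dh : is_derive t 1 (fun y => \int[mu]_(s in `]a, y]) h s) (h t).
    by apply: DeriveDef; [exact: dH|rewrite -HE derive1E].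
  by have := is_deriveD (is_derive_cst (F a) t 1) dh; rewrite add0r.
(* The integral formula holds only on [[a, b]], hence in a neighbourhood of the interior point
   [t]. *)
apply: (@near_eq_is_derive _ _ _ (fun y => F a + \int[mu]_(s in `]a, y]) h s)) => //.
near=> y; rewrite -hE ?subrKC//; apply/andP; split; apply/ltW.
- by near: y; exact: lt_nbhsr.
- by near: y; exact: lt_nbhsl.
Unshelve. all: by end_near. Qed.

Lemma abs_continuous_derive_le0 a b F : a <= b -> abs_continuous F ->
  {ae mu, forall t, a < t < b -> derivable F t 1 -> 'D_1 F t <= 0} ->
  F b <= F a.
Proof.
move=> ab acF dF0; have [h [ih hE hD]] := abs_continuous_density ab acF.
rewrite -subr_le0 hE ?ab ?lexx//.
rewrite -Rintegral_itv_bndo_bndc; last exact: integrableS ih.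
have ihab : mu.-integrable `]a, b[ (EFin \o h) by exact: integrableS ih.
have mh : measurable_fun `]a, b[ h by apply/measurable_EFinP; exact: measurable_int ihab.
(* The density is nonpositive only almost everywhere; truncation makes it so at every point without
   changing the integral. *)
pose h' x := Num.min (h x) 0.
have -> : \int[mu]_(x in `]a, b[) h x = \int[mu]_(x in `]a, b[) h' x.
  congr fine; apply: ae_eq_integral => //.
  - exact/measurable_EFinP.
  - by apply/measurable_EFinP; exact: measurable_minr.
  - move: hD dF0; apply: filterS2; first exact: (ae_filter_ringOfSetsType mu).
    move=> t hD dF0 /=; rewrite in_itv/= => tab.
    have [dF htE] := hD tab.
    by rewrite /h' (min_idPl _)// -htE; exact: dF0.
have ih' : mu.-integrable `]a, b[ (EFin \o h').
  apply: le_integrable ihab => //.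
    by apply/measurable_EFinP; exact: measurable_minr.
  by move=> x _; rewrite /= lee_fin /h'; have [h0|h0] := leP (h x) 0; rewrite ?normr0.
have := @le_Rintegral _ _ _ mu `]a, b[ h' (fun=> 0).
rewrite Rintegral_cst// mul0r; apply => //; first exact: integrable0.
by move=> x _; rewrite ge_min lexx orbT.
Qed.

(** If [F b] were positive, there would be a last time [s] with [F s <= 0]. After [s] the function
    is positive, so its derivative is nonpositive almost everywhere and [F b <= F s], a
    contradiction. *)
Lemma abs_continuous_comparison a b F : a <= b -> abs_continuous F -> F a <= 0 ->
  {ae mu, forall t, a < t < b -> 0 < F t -> derivable F t 1 -> 'D_1 F t <= 0} ->
  F b <= 0.
Proof.
move=> ab acF Fa dF; rewrite leNgt; apply/negP => Fb.
have cF := abs_continuous_continuous acF.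
pose A := [set t | a <= t <= b /\ F t <= 0].
have Aa : A a by split; rewrite ?lexx.
have supA : has_sup A by split; [exists a|exists b => t [/andP[]]].
pose s := sup A.
have clA : closed A.
  rewrite (_ : A = `[a, b]%classic `&` F @^-1` `]-oo, 0]%classic).
    apply: closedI; first exact: itv_closed.
    by apply: closed_comp => [? _|]; [exact: cF|exact: lray_closed].
  by apply/seteqP; split => t /=; rewrite !in_itv/=.
have [/andP[as_ sb] Fs] : A s.
  rewrite [X in X _](closure_id A).1//.
  by apply: closure_sup; [exact: supA.1|exact: supA.2].
suff : F b <= F s by move=> /le_trans/(_ Fs); rewrite leNgt Fb.
apply: abs_continuous_derive_le0 => //.
move: dF; apply: filterS; first exact: (ae_filter_ringOfSetsType mu).
move=> t dF /andP[st tb]; apply: dF.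
  by rewrite (le_lt_trans as_ st).
rewrite ltNge; apply/negP => Ft; move: (st); rewrite ltNge => /negP; apply.
apply: ub_le_sup; first exact: supA.2.
by split => //; rewrite (ltW tb) andbT (le_trans as_)// ltW.
Qed.

End density.

(** * Euclidean seminorms and their logarithmic norms *)

Section euclidean.
Context {R : realType}.

Definition dotmx n (x y : 'cV[R]_n) : R := \sum_i x i 0 * y i 0.

Lemma dotmxE n (x y : 'cV[R]_n) : dotmx x y = (x^T *m y) 0 0.
Proof. by rewrite mxE; apply: eq_bigr => i _; rewrite mxE. Qed.

Lemma dotmxDr n (x y z : 'cV[R]_n) : dotmx x (y + z) = dotmx x y + dotmx x z.
Proof. by rewrite !dotmxE mulmxDr mxE. Qed.

Lemma dotmxC n (x y : 'cV[R]_n) : dotmx x y = dotmx y x.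
Proof. by apply: eq_bigr => i _; rewrite mulrC. Qed.

Lemma dotmxDl n (x y z : 'cV[R]_n) : dotmx (x + y) z = dotmx x z + dotmx y z.
Proof. by rewrite dotmxC dotmxDr !(dotmxC z). Qed.

Lemma dotmxZr n k (x y : 'cV[R]_n) : dotmx x (k *: y) = k * dotmx x y.
Proof. by rewrite !dotmxE -scalemxAr mxE. Qed.

Lemma dotmxZl n k (x y : 'cV[R]_n) : dotmx (k *: x) y = k * dotmx x y.
Proof. by rewrite dotmxC dotmxZr dotmxC. Qed.

Lemma dotmx0l n (x : 'cV[R]_n) : dotmx 0 x = 0.
Proof. by apply: big1 => i _; rewrite mxE mul0r. Qed.

Lemma dotmx0r n (x : 'cV[R]_n) : dotmx x 0 = 0.
Proof. by rewrite dotmxC dotmx0l. Qed.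

Lemma dotmxx_ge0 n (x : 'cV[R]_n) : 0 <= dotmx x x.
Proof. by apply: sumr_ge0 => i _; rewrite -expr2 sqr_ge0. Qed.

Lemma norm2E n (x : 'cV[R]_n) : norm2 x = Num.sqrt (dotmx x x).
Proof. by congr Num.sqrt; apply: eq_bigr => i _; rewrite expr2. Qed.

Lemma sqr_norm2 n (x : 'cV[R]_n) : norm2 x ^+ 2 = dotmx x x.
Proof. by rewrite norm2E sqr_sqrtr// dotmxx_ge0. Qed.

Lemma norm2_ge0 n (x : 'cV[R]_n) : 0 <= norm2 x.
Proof. exact: sqrtr_ge0. Qed.

Lemma norm2_eq0 n (x : 'cV[R]_n) : norm2 x = 0 -> x = 0.
Proof.
move=> x0; have := sqr_norm2 x; rewrite x0 expr0n/= => /esym/eqP.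
rewrite psumr_eq0 => [/allP xi0|i _]; last by rewrite -expr2 sqr_ge0.
apply/matrixP => i j; rewrite ord1 mxE; apply/eqP.
by have := xi0 i; rewrite mem_index_enum -expr2 sqrf_eq0; exact.
Qed.

Lemma norm2_0 n : norm2 (0 : 'cV[R]_n) = 0.
Proof. by rewrite norm2E dotmx0l sqrtr0. Qed.

Lemma norm2Z n k (x : 'cV[R]_n) : norm2 (k *: x) = `|k| * norm2 x.
Proof.
by rewrite !norm2E dotmxZl dotmxZr mulrA -expr2 sqrtrM ?sqr_ge0// sqrtr_sqr.
Qed.

Lemma dotmx_le n (x y : 'cV[R]_n) : dotmx x y <= norm2 x * norm2 y.
Proof.
have [/norm2_eq0->|x0] := eqVneq (norm2 x) 0.
  by rewrite norm2_0 mul0r dotmx0l.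
have [/norm2_eq0->|y0] := eqVneq (norm2 y) 0.
  by rewrite norm2_0 mulr0 dotmx0r.
have xy0 : 0 < norm2 x * norm2 y by rewrite mulr_gt0// lt0r ?x0 ?y0 norm2_ge0.
(* The square expands to twice |x||y| (|x||y| - <x, y>), and |x||y| is positive. *)
have := dotmxx_ge0 (norm2 y *: x + (- norm2 x) *: y).
rewrite !(dotmxDl, dotmxDr, dotmxZl, dotmxZr) -!sqr_norm2 (dotmxC y x).
nra.
Qed.

Lemma ler_norm2D n (x y : 'cV[R]_n) : norm2 (x + y) <= norm2 x + norm2 y.
Proof.
rewrite -(@ler_pXn2r _ 2) ?nnegrE ?addr_ge0 ?norm2_ge0//.
rewrite sqrrD !sqr_norm2 dotmxDl !dotmxDr (dotmxC y x).
by have := dotmx_le x y; lra.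
Qed.

Lemma norm2_le_sum n (x : 'cV[R]_n) : norm2 x <= \sum_i `|x i 0|.
Proof.
rewrite -[leRHS]ger0_norm ?sumr_ge0// -sqrtr_sqr norm2E.
rewrite ler_wsqrtr// expr2 mulr_sumr; apply: ler_sum => i _.
rewrite (bigD1 i)//= mulrDl -[leLHS]addr0 lerD//.
  by rewrite -normrM ler_norm.
by rewrite mulr_ge0// sumr_ge0.
Qed.

(** This crude constant serves to bound the set whose supremum is [op_seminorm] and to compare the
    seminorm with the max norm. *)
Lemma norm2_mulmx_le p n (M : 'M[R]_(p, n)) (x : 'cV[R]_n) k :
  (forall j, `|x j 0| <= k) ->
  norm2 (M *m x) <= (\sum_i \sum_j `|M i j|) * k.
Proof.
move=> xk; apply: le_trans (norm2_le_sum _) _.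
rewrite mulr_suml; apply: ler_sum => i _; rewrite mxE mulr_suml.
apply: le_trans (ler_norm_sum _ _ _) _; apply: ler_sum => j _.
by rewrite normrM ler_wpM2l.
Qed.

Lemma coef_le_norm2 n (x : 'cV[R]_n) i : `|x i 0| <= norm2 x.
Proof.
rewrite -sqrtr_sqr norm2E ler_wsqrtr// /dotmx (bigD1 i)//= -expr2 lerDl.
by apply: sumr_ge0 => j _; rewrite -expr2 sqr_ge0.
Qed.

End euclidean.

(** * The logarithmic norm as a bound on a quadratic form *)

Section lognorm.
Context {R : realType} {p n : nat} (P : 'M[R]_(p, n)).
Hypothesis PPt : P *m P^T = 1%:M.

(** Since [P *m P^T = 1], the matrix [P^T *m P] is the orthogonal projection onto the complement of
    the kernel, so it fixes [z]. *)
Lemma orth_ker_norm2 (z : 'cV[R]_n) : orth_ker P z -> norm2 z = seminorm P z.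
Proof.
move=> zP; have Py : ker P (z - P^T *m (P *m z)).
  by rewrite /ker/= mulmxBr [P *m (P^T *m _)]mulmxA PPt mul1mx subrr.
have zE : z = P^T *m (P *m z).
  apply/eqP; rewrite -subr_eq0; apply/eqP/norm2_eq0.
  rewrite norm2E dotmxE mulmxBr (zP _ Py) [_ *m (P^T *m _)]mulmxA -trmx_mul Py trmx0 mul0mx.
  by rewrite subrr mxE sqrtr0.
by rewrite /seminorm !norm2E !dotmxE {2}zE trmx_mul !mulmxA.
Qed.

Let unit_sphere := orth_ker P `&` [set z | seminorm P z = 1].

Lemma has_ubound_op_seminorm (A : 'M[R]_n) :
  has_ubound [set seminorm P (A *m z) | z in unit_sphere].
Proof.
exists ((\sum_i \sum_j `|(P *m A) i j|) * 1) => _ [z [zP z1] <-].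
rewrite /seminorm mulmxA; apply: norm2_mulmx_le => j.
by rewrite (le_trans (coef_le_norm2 _ _))// orth_ker_norm2// z1.
Qed.

Lemma seminorm_le_op (A : 'M[R]_n) z : orth_ker P z -> seminorm P z = 1 ->
  seminorm P (A *m z) <= op_seminorm P A.
Proof.
by move=> zP z1; apply: ub_le_sup; [exact: has_ubound_op_seminorm|exists z].
Qed.

(** The witness [z] keeps the set under the supremum nonempty. *)
Lemma op_seminorm_le (A : 'M[R]_n) z k : orth_ker P z -> seminorm P z = 1 ->
  (forall y, orth_ker P y -> seminorm P y = 1 -> seminorm P (A *m y) <= k) ->
  op_seminorm P A <= k.
Proof.
move=> zP z1 Ak; apply: ge_sup; first by exists (seminorm P (A *m z)), z.
by move=> _ [y [yP y1] <-]; exact: Ak.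
Qed.

Lemma seminormD x y : seminorm P (x + y) <= seminorm P x + seminorm P y.
Proof. by rewrite /seminorm mulmxDr ler_norm2D. Qed.

Lemma seminormZ k x : seminorm P (k *: x) = `|k| * seminorm P x.
Proof. by rewrite /seminorm -scalemxAr norm2Z. Qed.

(** By Cauchy-Schwarz, 1 + h <Pz, PAz> is at most the operator seminorm of 1 + hA, so every
    difference quotient is at least <Pz, PAz>; this survives the limit. *)
Lemma dotmx_le_lognorm_unit (A : 'M[R]_n) z : orth_ker P z -> seminorm P z = 1 ->
  dotmx (P *m z) (P *m (A *m z)) <= lognorm P A.
Proof.
move=> zP z1.
have aux (u w s : R) : u <= (1 - s) + s * w -> u - 1 <= (w - 1) * s by lra.
pose q h := (op_seminorm P (1%:M + h *: A) - 1) / h.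
have lb h : 0 < h -> dotmx (P *m z) (P *m (A *m z)) <= q h.
  move=> h0; rewrite ler_pdivlMr// lerBrDr.
  apply: le_trans (seminorm_le_op (1%:M + h *: A) zP z1).
  apply: le_trans (_ : dotmx (P *m z) (P *m ((1%:M + h *: A) *m z)) <= _).
    rewrite mulmxDl mul1mx mulmxDr dotmxDr -scalemxAl -scalemxAr dotmxZr.
    by rewrite -sqr_norm2 -[norm2 _]/(seminorm P z) z1 expr1n addrC mulrC.
  apply: le_trans (dotmx_le _ _) _.
  by rewrite -[norm2 (P *m z)]/(seminorm P z) z1 mul1r.
have ndq : {in `]0, +oo[ &, {homo q : h k / h <= k}}.
  move=> h k; rewrite !in_itv/= !andbT => h0 k0 hk.
  rewrite ler_pdivrMr// -mulrA [k^-1 * _]mulrC -/(h / k).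
  set r := h / k.
  have r0 : 0 <= r by rewrite divr_ge0// ltW.
  have r1 : r <= 1 by rewrite ler_pdivrMr// mul1r.
  have hE : r * k = h by rewrite divfK// gt_eqF.
  (* Monotonicity of the quotient comes from convexity in [h]: 1 + hA is the combination of 1 and 1
     + kA with weights [1 - r] and [r]. *)
  suff : op_seminorm P (1%:M + h *: A) <=
      (1 - r) + r * op_seminorm P (1%:M + k *: A).
    by move=> opk; apply: aux.
  apply: (op_seminorm_le zP z1) => y yP y1.
  have -> : (1%:M + h *: A) *m y = (1 - r) *: y + r *: ((1%:M + k *: A) *m y).
    rewrite !mulmxDl !mul1mx -!scalemxAl scalerDr scalerA hE addrA -scalerDl.
    by rewrite subrK scale1r.
  apply: le_trans (seminormD _ _) _; rewrite !seminormZ !ger0_norm ?subr_ge0//.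
  by rewrite y1 mulr1 lerD2l ler_wpM2l// seminorm_le_op.
(* Without convergence [lim] would be a mere default value; monotonicity and the lower bound provide
   it. *)
have cq : cvg (q h @[h --> 0^'+]).
  apply: nondecreasing_at_right_is_cvgr.
    near=> x => y w; rewrite !in_itv/= => /andP[y0 _] /andP[w0 _] yw.
    by apply: ndq; rewrite ?in_itv/= ?andbT.
  near=> x; exists (dotmx (P *m z) (P *m (A *m z))) => _ [h + <-].
  by rewrite /= in_itv/= => /andP[h0 _]; exact: lb.
apply: (@limr_ge _ _ _ _ _ _ cq); near=> h; apply: lb.
by near: h; exact: nbhs_right_gt.
Unshelve. all: by end_near. Qed.

(** Replace [e] by its component orthogonal to the kernel and normalize. The discarded component
    lies in the kernel, and so does its image under [A], so [P] kills both. *)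
Lemma dotmx_le_lognorm (A : 'M[R]_n) e :
  (forall v, ker P v -> ker P (A *m v)) ->
  dotmx (P *m e) (P *m (A *m e)) <= lognorm P A * seminorm P e ^+ 2.
Proof.
move=> kerA; set V := seminorm P e.
have [V0|V0] := eqVneq V 0.
  by rewrite (norm2_eq0 V0) V0 expr0n/= mulr0 dotmx0l.
have V_gt0 : 0 < V by rewrite lt0r V0 norm2_ge0.
pose z := V^-1 *: (P^T *m (P *m e)).
have Pz : P *m z = V^-1 *: (P *m e).
  by rewrite -scalemxAr [P *m (P^T *m _)]mulmxA PPt mul1mx.
have zP : orth_ker P z.
  move=> v Pv; rewrite -scalemxAr [v^T *m (P^T *m _)]mulmxA -trmx_mul.
  by rewrite (_ : P *m v = 0)// trmx0 mul0mx scaler0.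
have z1 : seminorm P z = 1.
  rewrite /seminorm Pz norm2Z -[norm2 _]/V ger0_norm ?invr_ge0 ?ltW//.
  by rewrite mulVf.
have ke : ker P (e - V *: z).
  by rewrite /ker/= mulmxBr -scalemxAr Pz scalerA mulfV// scale1r subrr.
have PAe : P *m (A *m e) = V *: (P *m (A *m z)).
  have := kerA _ ke; rewrite /ker/= !mulmxBr -!scalemxAr => /eqP.
  by rewrite subr_eq0 => /eqP.
have Pe : P *m e = V *: (P *m z) by rewrite Pz scalerA mulfV// scale1r.
rewrite PAe {1}Pe dotmxZl dotmxZr mulrA -expr2 mulrC.
by rewrite ler_wpM2r ?sqr_ge0// dotmx_le_lognorm_unit.
Qed.

(** Translations along the kernel do not change the seminorm, so the infimum runs over a single
    value. *)
Lemma dist_mod_kerE x y : dist_mod_ker P x y = seminorm P (x - y).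
Proof.
rewrite /dist_mod_ker (_ : [set _ | v in _] = [set seminorm P (x - y)]).
  exact: inf1.
apply/seteqP; split => [_ [v Pv <-]|_ ->].
  by rewrite /= /seminorm opprD addrA mulmxBr Pv subr0.
by exists 0; rewrite ?addr0// /ker/= mulmx0.
Qed.

End lognorm.

(** * Vector fields along segments *)

Section derivatives.
Context {R : realType}.

Lemma is_derive_coord m n (u : R -> 'M[R]_(m, n)) (t : R) du i j :
  is_derive t 1 u du -> is_derive t 1 (fun s => u s i j) (du i j).
Proof.
move=> [dut <-]; split; first exact: (derivable_mxP u t 1).1.
by rewrite derive_mx// mxE.
Qed.

Lemma is_derive_fct_sum n (h : 'I_n -> R -> R) (t : R) (dh : 'I_n -> R) :
  (forall i, is_derive t 1 (h i) (dh i)) ->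
  is_derive t 1 (fun s => \sum_i h i s) (\sum_i dh i).
Proof.
move=> dht; rewrite (_ : (fun s => _) = \sum_i h i).
  exact: is_derive_sum.
by apply/funext => s; rewrite fct_sumE.
Qed.

Lemma is_derive_dotmx n (c : 'cV[R]_n) (u : R -> 'cV[R]_n) (t : R) du :
  is_derive t 1 u du ->
  is_derive t 1 (fun s => dotmx c (u s)) (dotmx c du).
Proof.
move=> dut; apply: is_derive_fct_sum => i.
exact: is_deriveZ (is_derive_coord i 0 dut).
Qed.

Lemma dotmx_mulmx p n (M : 'M[R]_(p, n)) (x : 'cV[R]_p) y :
  dotmx x (M *m y) = dotmx (M^T *m x) y.
Proof. by rewrite !dotmxE trmx_mul trmxK mulmxA. Qed.

Lemma is_derive_mulmx_sqr p n (M : 'M[R]_(p, n)) (u : R -> 'cV[R]_n) (t : R) du :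
  is_derive t 1 u du ->
  is_derive t 1 (fun s => dotmx (M *m u s) (M *m u s))
    (2 * dotmx (M *m u t) (M *m du)).
Proof.
move=> dut; rewrite mulr_sumr; apply: is_derive_fct_sum => i.
have dMu : is_derive t 1 (fun s => (M *m u s) i 0) ((M *m du) i 0).
  rewrite (_ : (fun s => _) = (fun s => dotmx (row i M)^T (u s))).
    rewrite (_ : (M *m du) i 0 = dotmx (row i M)^T du); first exact: is_derive_dotmx.
    by rewrite mxE; apply: eq_bigr => j _; rewrite !mxE.
  by apply/funext => s; rewrite mxE; apply: eq_bigr => j _; rewrite !mxE.
by rewrite mulr_natl mulr2n; exact: (is_deriveM dMu dMu).
Qed.

End derivatives.

Section vector_field.
Context {R : realType} {n : nat} (f : 'cV[R]_n -> R -> 'cV[R]_n).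

Lemma derive_DfE x t e : differentiable (f^~ t) x ->
  'D_e (f^~ t) x = Df f x t *m e.
Proof.
move=> dfx; rewrite deriveE//.
have -> : 'd (f^~ t) x e = \sum_j e j 0 *: 'd (f^~ t) x (delta_mx j 0).
  have {1}-> : e = \sum_j e j 0 *: delta_mx j 0.
    rewrite {1}(matrix_sum_delta e); apply: eq_bigr => j _.
    by rewrite big_ord1.
  by rewrite linear_sum; apply: eq_bigr => j _; rewrite linearZ.
apply/matrixP => i k; rewrite ord1 summxE mxE; apply: eq_bigr => j _.
by rewrite !mxE -deriveE// mulrC.
Qed.

Lemma is_derive_segment y e t (s : R) : differentiable (f^~ t) (y + s *: e) ->
  is_derive s 1 (fun r => f (y + r *: e) t) (Df f (y + s *: e) t *m e).
Proof.
move=> dfy; rewrite -(derive_DfE _ dfy).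
have E : (fun h => h^-1 *: (f (y + (h *: 1 + s) *: e) t - f (y + s *: e) t)) =
    (fun h => h^-1 *: (f (h *: e + (y + s *: e)) t - f (y + s *: e) t)).
  apply/funext => h; congr (_ *: (f _ t - _)).
  by rewrite scalerDl [h *: 1]mulr1 addrCA.
have dfe : derivable (f^~ t) (y + s *: e) e by exact: diff_derivable.
split; first by rewrite /derivable/= E.
by rewrite /derive/= E.
Qed.

(** The mean value theorem needs a scalar function: it is applied to the component of the field
    along [w]. Convexity of [D] keeps the intermediate point where the bound on the Jacobian
    holds. *)
Lemma semi_contracting_dotmx p (P : 'M[R]_(p, n)) (D : set 'cV[R]_n) c x y t :
  P *m P^T = 1%:M -> C1_in_space f -> convex_set D ->
  semi_contracting f P D c -> ker_infinitesimally_invariant f P D ->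
  0 <= t -> D x -> D y ->
  dotmx (P *m (x - y)) (P *m (f x t - f y t)) <= - c * seminorm P (x - y) ^+ 2.
Proof.
move=> PPt C1f cD contr kerinv t0 Dx Dy; set e := x - y.
pose w := P^T *m (P *m e).
have wE z : dotmx (P *m e) (P *m z) = dotmx w z by rewrite dotmx_mulmx.
pose g r := dotmx w (f (y + r *: e) t).
have dg (r : R) : is_derive r 1 g (dotmx w (Df f (y + r *: e) t *m e)).
  by apply: is_derive_dotmx; apply: is_derive_segment; exact: (C1f t t0).1.
have [r r01] : exists2 r, r \in `]0, 1[%R &
    g 1 - g 0 = dotmx w (Df f (y + r *: e) t *m e) * (1 - 0).
  apply: MVT => //; apply: continuous_subspaceT => r.
  by apply/differentiable_continuous/derivable1_diffP; have [] := dg r.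
rewrite subr0 mulr1 /g scale1r scale0r addr0 subrKC => gE.
have Dr : D (y + r *: e).
  move: r01; rewrite in_itv/= => /andP[r0 r1].
  have -> : y + r *: e = r *: x + (1 - r) *: y.
    by rewrite scalerBl scale1r scalerBr addrCA.
  by have := cD x y (Itv01 (ltW r0) (ltW r1)); rewrite !inE => /(_ Dx Dy).
rewrite wE -[f x t - _]addr0.
have -> : dotmx w (f x t - f y t + 0) = dotmx w (Df f (y + r *: e) t *m e).
  by rewrite addr0 -gE -scaleN1r dotmxDr dotmxZr mulN1r.
rewrite -wE; apply: le_trans (dotmx_le_lognorm PPt _ _) _.
  by move=> v; exact: kerinv.
by rewrite ler_wpM2r ?sqr_ge0//; exact: contr.
Qed.

End vector_field.

(** * The tube estimate *)

Section tube.
Context {R : realType}.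
Local Notation mu := (@lebesgue_measure R).

Lemma coef_le_mx_norm n (x : 'cV[R]_n) i : `|x i 0| <= `|x|.
Proof.
rewrite [leRHS]/Num.Def.normr/= mx_normrE.
exact: (le_bigmax _ (fun ij => `|x ij.1 ij.2|) (i, 0)).
Qed.

Lemma seminorm_le_mx_norm p n (P : 'M[R]_(p, n)) x :
  seminorm P x <= (\sum_i \sum_j `|P i j|) * `|x|.
Proof. by apply: norm2_mulmx_le => j; exact: coef_le_mx_norm. Qed.

Lemma seminorm_dist p n (P : 'M[R]_(p, n)) x y :
  `|seminorm P x - seminorm P y| <= seminorm P (x - y).
Proof.
have tri u v : seminorm P u <= seminorm P (u - v) + seminorm P v.
  by rewrite -{1}(subrK v u) seminormD.
have := tri x y; have := tri y x.
have -> : seminorm P (y - x) = seminorm P (x - y).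
  by rewrite -opprB -scaleN1r seminormZ normrN1 mul1r.
by rewrite ler_norml; lra.
Qed.

(** Multiply by A + B: |A - B|(A + B) = |a - b|(a + b), and a + b is at most A + B. Thus the smooth
    substitute inherits absolute continuity from the seminorm. *)
Lemma sqrt_sqrD_contract (h a b : R) : 0 < h -> 0 <= a -> 0 <= b ->
  `|Num.sqrt (a ^+ 2 + h ^+ 2) - Num.sqrt (b ^+ 2 + h ^+ 2)| <= `|a - b|.
Proof.
move=> h0 a0 b0.
have sq0 (r : R) : 0 <= r ^+ 2 + h ^+ 2 by rewrite addr_ge0// sqr_ge0.
have le_sqrt r : 0 <= r -> r <= Num.sqrt (r ^+ 2 + h ^+ 2).
  by move=> r0; rewrite -[leLHS](ger0_norm r0) -sqrtr_sqr ler_wsqrtr// lerDl sqr_ge0.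
set A := Num.sqrt _; set B := Num.sqrt _.
have A0 : 0 < A by rewrite sqrtr_gt0 ltr_wpDl ?sqr_ge0 ?exprn_gt0.
have B0 : 0 < B by rewrite sqrtr_gt0 ltr_wpDl ?sqr_ge0 ?exprn_gt0.
have AB0 : 0 < A + B by rewrite addr_gt0.
rewrite -(ler_pM2r AB0) -{1}(gtr0_norm AB0) -normrM -subr_sqr !sqr_sqrtr//.
rewrite opprD addrACA subrr addr0 subr_sqr normrM ler_wpM2l// ger0_norm ?addr_ge0//.
by rewrite lerD ?le_sqrt.
Qed.

Lemma near_clamp (a b t : R) : a < t < b -> \forall s \near t, clamp a b s = s.
Proof.
move=> /andP[at_ tb]; near=> s; rewrite clamp_id//.
by apply/andP; split; apply/ltW; near: s; [exact: lt_nbhsr|exact: lt_nbhsl].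
Unshelve. all: by end_near. Qed.

(** Each clamped coordinate has a density, hence a derivative almost everywhere; the finitely many
    exceptional null sets are merged. *)
Lemma loc_abs_continuous_ae_derivable n (J : set R) (g : R -> 'cV[R]_n) a b :
  a <= b -> loc_abs_continuous J g -> `[a, b]%classic `<=` J ->
  {ae mu, forall t, a < t < b -> derivable g t 1}.
Proof.
move=> ab acg abJ.
have aeF (i : 'I_n) : {ae mu, forall t, a < t < b -> derivable (fun s => g s i 0) t 1}.
  have acF : abs_continuous ((fun s => g s i 0) \o clamp a b).
    apply: abs_continuous_clamp => //.
    apply: le_abs_continuous_increments (loc_abs_continuous_increments acg abJ).
    move=> s t _ _ _; apply: le_trans (coef_le_mx_norm _ i).
    by rewrite !mxE.
  have [h [_ _]] := abs_continuous_density ab acF.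
  apply: filterS; first exact: (ae_filter_ringOfSetsType mu).
  move=> t dF tab; have [+ _] := dF tab; apply: near_eq_derivable.
  by apply: filterS (near_clamp tab) => s /= ->.
have FF : Filter (nbhs (almost_everywhere mu)) := ae_filter_ringOfSetsType mu.
have aeG : {ae mu, forall t, forall i : 'I_n,
    a < t < b -> derivable (fun s => g s i 0) t 1}.
  by apply: filter_forall; exact: aeF.
apply: filterS aeG => t dg tab; apply/derivable_mxP => i j; rewrite ord1.
exact: dg.
Qed.

End tube.

(** * The differential inequality along a solution *)

Section main_estimate.
Context {R : realType} {p n : nat} (P : 'M[R]_(p, n)).
Local Notation mu := (@lebesgue_measure R).
Hypothesis PPt : P *m P^T = 1%:M.
Variables (f : 'cV[R]_n -> R -> 'cV[R]_n) (D : set 'cV[R]_n) (c : R).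
Hypotheses (C1f : C1_in_space f) (cD : convex_set D) (c0 : 0 < c).
Hypothesis contr : semi_contracting f P D c.
Hypothesis kerinv : ker_infinitesimally_invariant f P D.
Variables (xc : R -> 'cV[R]_n) (rho : R -> R).
Hypothesis acxc : loc_abs_continuous [set t : R | 0 <= t] xc.
Hypothesis Dxc : forall t, 0 <= t -> D (xc t).
Hypothesis solrho : solution
  (fun (y : R^o) t => - c * y + seminorm P (residual f xc t))
  [set t : R | 0 <= t] rho.

(** A positive [h] keeps the argument of the root away from 0, where the seminorm itself may fail to
    be differentiable. *)
Lemma is_derive_smooth_seminorm (h : R) (u : R -> 'cV[R]_n) (t : R) du :
  0 < h -> is_derive t 1 u du ->
  is_derive t 1 (fun s => Num.sqrt (seminorm P (u s) ^+ 2 + h ^+ 2))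
    (dotmx (P *m u t) (P *m du) / Num.sqrt (seminorm P (u t) ^+ 2 + h ^+ 2)).
Proof.
move=> h0 dut.
have pos : 0 < seminorm P (u t) ^+ 2 + h ^+ 2.
  by rewrite ltr_wpDl ?sqr_ge0 ?exprn_gt0.
have dsq : is_derive t 1 (fun s => seminorm P (u s) ^+ 2 + h ^+ 2)
    (2 * dotmx (P *m u t) (P *m du)).
  rewrite (_ : (fun s => _) = (fun s => dotmx (P *m u s) (P *m u s)) + cst (h ^+ 2)).
    by rewrite -[X in is_derive _ _ _ X]addr0; apply: is_deriveD; exact: is_derive_mulmx_sqr.
  by apply/funext => s; rewrite /seminorm sqr_norm2.
have := @is_derive1_comp _ Num.sqrt (fun s => seminorm P (u s) ^+ 2 + h ^+ 2)
  _ _ _ (is_derive1_sqrt pos) dsq.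
by rewrite invfM mulrACA mulVf// mul1r mulrC.
Qed.

(** The start [a] is arbitrary and only [[a, b]] matters, so that both the bound from time 0 and
    forward invariance follow. *)
Lemma seminorm_estimate (J : set R) (x : R -> 'cV[R]_n) (a b : R) :
  0 <= a -> a <= b -> `[a, b]%classic `<=` J -> solution f J x ->
  (forall t, a <= t <= b -> D (x t)) ->
  seminorm P (x a - xc a) <= rho a -> seminorm P (x b - xc b) <= rho b.
Proof.
move=> a0 ab abJ [acx dx] Dx xa.
have ab0 : `[a, b]%classic `<=` [set t : R | 0 <= t].
  by move=> t /=; rewrite in_itv/= => /andP[/(le_trans a0)].
have [acrho drho] := solrho.
apply/ler_addgt0Pr => h h0.
pose e t := x t - xc t.
pose S t := Num.sqrt (seminorm P (e t) ^+ 2 + h ^+ 2).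
(* Subtracting [h] absorbs the excess of [S] over the seminorm at time [a]; at time [b] it costs the
   [h] allowed in the goal. *)
pose w t := S t - rho t - h.
have V_ge0 t : 0 <= seminorm P (e t) by exact: norm2_ge0.
have S_gt0 t : 0 < S t by rewrite sqrtr_gt0 ltr_wpDl ?sqr_ge0 ?exprn_gt0.
have S2 t : S t ^+ 2 = seminorm P (e t) ^+ 2 + h ^+ 2.
  by rewrite sqr_sqrtr// addr_ge0// sqr_ge0.
have VS t : seminorm P (e t) <= S t.
  by rewrite -(@ler_pXn2r _ 2) ?nnegrE ?(ltW (S_gt0 t))// S2 lerDl sqr_ge0.
have SVh t : S t <= seminorm P (e t) + h.
  rewrite -(@ler_pXn2r _ 2) ?nnegrE ?(ltW (S_gt0 t)) ?addr_ge0 ?(ltW h0)//.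
  by rewrite S2 sqrrD lerD2r lerDl mulrn_wge0// mulr_ge0// ltW.
suff wb : w b <= 0 by have := VS b; rewrite /w in wb *; lra.
have acw : abs_continuous (w \o clamp a b).
  apply: abs_continuous_clamp => //.
  pose K := \sum_i \sum_j `|P i j|.
  have K0 : 0 <= K by apply: sumr_ge0 => i _; exact: sumr_ge0.
  have acS := abs_continuous_incrementsZ K0
    (abs_continuous_incrementsD (loc_abs_continuous_increments acx abJ)
                                (loc_abs_continuous_increments acxc ab0)).
  apply: le_abs_continuous_increments (abs_continuous_incrementsD acS
    (loc_abs_continuous_increments acrho ab0)) => s t _ _ _.
  (* Increments of [w] are bounded by those of [x], [xc] and [rho], each absolutely continuous. *)
  have -> : w t - w s = (S t - S s) - (rho t - rho s) by rewrite /w; ring.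
  apply: le_trans (ler_normB _ _) _; rewrite lerD2r.
  apply: le_trans (sqrt_sqrD_contract h0 (V_ge0 t) (V_ge0 s)) _.
  apply: le_trans (seminorm_dist _ _ _) _.
  apply: le_trans (seminorm_le_mx_norm _ _) _.
  rewrite ler_wpM2l//; apply: le_trans (ler_normB _ _).
  rewrite (_ : e t - e s = (x t - x s) - (xc t - xc s))//.
  by rewrite /e !opprB addrACA [RHS]addrACA [- xc t + _]addrC.
have wa : w a <= 0 by have := SVh a; rewrite /w -/(e a) in xa *; lra.
have clampE t : a <= t <= b -> (w \o clamp a b) t = w t by move=> ?; rewrite /= clamp_id.
rewrite -clampE ?ab ?lexx//; apply: (abs_continuous_comparison ab acw).
  by rewrite clampE ?ab ?lexx.
have FF : Filter (nbhs (almost_everywhere mu)) := ae_filter_ringOfSetsType mu.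
have dxc := loc_abs_continuous_ae_derivable ab acxc ab0.
move: dx drho dxc; apply: filterS3 => t dx drho dxc tab.
have [at_ tb] := andP tab.
have tab' : a <= t <= b by rewrite !ltW.
have t0 : 0 <= t by apply: le_trans a0 (ltW at_).
rewrite clampE// => wt _.
have de : is_derive t 1 e (f (x t) t - derive1 xc t).
  apply: is_deriveB; first by apply: dx; apply: abJ; rewrite /= in_itv.
  by apply: DeriveDef; [exact: dxc|rewrite derive1E].
have [_ dw] : is_derive t 1 w (dotmx (P *m e t) (P *m (f (x t) t - derive1 xc t))
    / S t - (- c * rho t + seminorm P (residual f xc t)) - 0).
  apply: is_deriveB; apply: is_deriveB; last exact: drho.
  exact: is_derive_smooth_seminorm.
have -> : 'D_1 (w \o clamp a b) t = 'D_1 w t.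
  apply: near_eq_derive; apply: filterS (near_clamp tab) => s /= ->.
  by [].
rewrite dw.
(* The first difference is governed by contraction, the residual by Cauchy-Schwarz. *)
have -> : f (x t) t - derive1 xc t = (f (x t) t - f (xc t) t) + residual f xc t.
  by rewrite /residual addrA subrK.
rewrite [P *m (_ + residual f xc t)]mulmxDr dotmxDr.
have := semi_contracting_dotmx PPt C1f cD contr kerinv t0 (Dx t tab') (Dxc t0).
have := dotmx_le (P *m e t) (P *m residual f xc t).
rewrite -/(seminorm P (e t)) -/(seminorm P (residual f xc t)) -/(e t) -/(S t).
have r0 : 0 <= seminorm P (residual f xc t) by exact: norm2_ge0.
move: wt (S_gt0 t) (S2 t) (VS t) (V_ge0 t) r0; rewrite /w.
move: (S t) (seminorm P (e t)) (seminorm P (residual f xc t)) (rho t) => s V r q.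
move: (dotmx _ _) (dotmx _ _) => k l wt s0 s2 Vs V0 r0 kle lle.
rewrite subr0 subr_le0 ler_pdivrMr//.
have hs : h <= s by rewrite -(@ler_pXn2r _ 2) ?nnegrE ?(ltW h0) ?(ltW s0)// s2 lerDr sqr_ge0.
have h1 : 0 <= c * s * (s - q - h) by rewrite !mulr_ge0// ltW.
have h2 : 0 <= c * h * (s - h) by rewrite !mulr_ge0 ?subr_ge0// ltW.
have h3 : V * r <= s * r by rewrite ler_wpM2r.
have h4 : V ^+ 2 = s ^+ 2 - h ^+ 2 by rewrite s2 addrK.
rewrite h4 in lle.
apply: le_trans (lerD lle (le_trans kle h3)) _.
(* The gap is a sum of two nonnegative terms: the first by positivity of [w], the second because [s]
   is at least [h]. The latter pays for having [s ^+ 2 - h ^+ 2] in place of [s ^+ 2]. *)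
rewrite -subr_ge0.
have -> : (- c * q + r) * s - (- c * (s ^+ 2 - h ^+ 2) + s * r) =
  c * s * (s - q - h) + c * h * (s - h) by ring.
exact: addr_ge0.
Qed.

End main_estimate.

Lemma blkR_mul_tr (R : realType) N (Rt : 'M[R]_(N.-1, N)) :
  Rt *m Rt^T = 1%:M -> blkR Rt *m (blkR Rt)^T = 1%:M.
Proof.
move=> RtRt; rewrite /blkR tr_block_mx !trmx0 trmx1 mulmx_block RtRt.
by rewrite !mulmx0 !mul0mx mulmx1 !addr0 add0r -scalar_mx_block.
Qed.

Theorem theorem2 (R : realType) (N : nat) (hN : (2 <= N)%N)
    (Rtheta : 'M[R]_(N.-1, N)) (hRtheta : orthonormal_rows_ones_perp Rtheta)
    (f : 'cV[R]_(N + N) -> R -> 'cV[R]_(N + N)) (hf : C1_in_space f)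
    (D : set 'cV[R]_(N + N)) (hD : convex_set D)
    (c : R) (hc : 0 < c)
    (hcontr : semi_contracting f (blkR Rtheta) D c)
    (hker : ker_infinitesimally_invariant f (blkR Rtheta) D)
    (xc : R -> 'cV[R]_(N + N))
    (hxc : loc_abs_continuous [set t : R | 0 <= t] xc)
    (hxcD : forall t, 0 <= t -> D (xc t))
    (rho : R -> R)
    (hrho : solution
      (fun (y : R^o) t => - c * y + seminorm (blkR Rtheta) (residual f xc t))
      [set t : R | 0 <= t] rho) :
  (forall x : R -> 'cV[R]_(N + N),
     solution f [set t : R | 0 <= t] x ->
     (forall t, 0 <= t -> D (x t)) ->
     dist_mod_ker (blkR Rtheta) (x 0) (xc 0) <= rho 0 ->
     forall t, 0 <= t -> dist_mod_ker (blkR Rtheta) (x t) (xc t) <= rho t) /\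
  forward_invariant f D (tube (blkR Rtheta) xc rho).
Proof.
have PPt := blkR_mul_tr hRtheta.1.
have estimate := seminorm_estimate PPt hf hD hc hcontr hker hxc hxcD hrho.
split=> [x solx Dx|t0 b x t00 J solx Dx].
  rewrite dist_mod_kerE => x0 t t0; rewrite dist_mod_kerE.
  apply: (estimate _ _ _ _ (lexx 0) t0 _ solx _ x0) => //.
    by move=> s /=; rewrite in_itv/= => /andP[].
  by move=> s /andP[+ _]; exact: Dx.
rewrite /tube /= dist_mod_kerE => xt0 t [t0t tb]; rewrite dist_mod_kerE.
have sJ s : t0 <= s <= t -> J s.
  by move=> /andP[t0s st]; split => //; apply: le_lt_trans tb; rewrite lee_fin.
apply: (estimate _ _ _ _ t00 t0t _ solx _ xt0) => //.
by move=> s /sJ; exact: Dx.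
Qed.
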